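(* Let $M$ be an $n$-dimensional smooth manifold and $U\subset M$ a coordinate chart. Let $\nabla,\tilde\nabla$ be the canonical connection with respect to a noncommutative metric $g$ and chiral coefficients $\Upsilon_{ijk}$ on $U$. Suppose that for all $q\in\mathbb{N}_0$ and all indices $i,j,k$, $$g_{ij}[2q]=g_{ji}[2q],\qquad g_{ij}[2q+1]=-g_{ji}[2q+1],\qquad \Upsilon_{ijk}[2q]=0.$$ Then the two Ricci curvatures are equivalent in the sense that for all $q\in\mathbb{N}_0$ and all $i,j$, $$R_{ij}[2q]=\Theta_{ji}[2q],\qquad R_{ij}[2q+1]=-\Theta_{ji}[2q+1],$$ and $$R^i_j[2q]=\Theta^i_j[2q],\qquad R^i_j[2q+1]=-\Theta^i_j[2q+1].$$
   Context: Indices $i,j,k,l,\dots$ range over $1,\dots,n$, and the Einstein summation convention is used. $U$ has coordinates $(x^1,\dots,x^n)$, $\partial_i=\partial/\partial x^i$. $\mathcal{A}_U=C^\infty(U)[[\hbar]]$ is the set of formal power series in the indeterminate $\hbar$ with real smooth coefficients; for $h\in\mathcal{A}_U$, $h[q]\in C^\infty(U)$ denotes the coefficient of $\hbar^q$. Fix a constant real skew-symmetric $n\times n$ matrix $(\theta^{ij})$. The Moyal product is $(u*v)(x)=\big[\exp(\hbar\theta^{ij}\partial_i\partial'_j)u(x)v(x')\big]_{x=x'}$ for $u,v\in C^\infty(U)$ (with $\partial'_j=\partial/\partial (x')^j$), extended $\mathbb{R}[[\hbar]]$-bilinearly to $\mathcal{A}_U$ (formal series in $\hbar$ being multiplied degree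 by degree); it is associative, and $\partial_i$ (extended coefficientwise) satisfies the Leibniz rule for $*$. Bundles and metric: $\mathcal{T}_U$ (resp. $\tilde{\mathcal{T}}_U$) is the free left (resp. right) $(\mathcal{A}_U,* )$-module with basis $E_1,\dots,E_n$ (resp. $\tilde E_1,\dots,\tilde E_n$), where $E_i=\tilde E_i=\partial_i$. A noncommutative metric is a homomorphism of two-sided $\mathcal{A}_U$-modules $g:\mathcal{T}_U\otimes_{\mathbb{R}[[\hbar]]}\tilde{\mathcal{T}}_U\to\mathcal{A}_U$ such that the matrix $g_{ij}=g(E_i,\tilde E_j)$ is invertible: there is a unique matrix $(g^{ij})$ over $\mathcal{A}_U$ with $g_{ik}*g^{kj}=g^{jk}*g_{ki}=\delta_i^j$. Connections: a noncommutative left (resp. right) connection is given by its covariant derivatives, $\mathbb{R}[[\hbar]]$-linear maps $\nabla_i:\mathcal{T}_U\to\mathcal{T}_U$ with $\nabla_i(f*V)=(\partial_if)*V+f*\nabla_iV$ (resp. $\tilde\nabla_i:\tilde{\mathcal{T}}_U\to\tilde{\mathcal{T}}_U$ with $\tilde\nabla_i(\tilde V*f)=\tilde V*(\partial_if)+\tilde\nabla_i\tilde V*f$) for $f\in\mathcal{A}_U$. Write $\nabla_iE_j=\Gamma_{ij}^k*E_k$, $\tilde\nabla_i\tilde E_j=\tilde E_k*\tilde\Gamma_{ij}^k$, $\Gamma_{ijk}=\Gamma_{ij}^l*g_{lk}$, $\tilde\Gamma_{ijk}=g_{kl}*\tilde\Gamma_{ij}^l$. Chiral coefficients are elements $\Upsilon_{ijk}\in\mathcal{A}_U$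 with $\Upsilon_{ijk}=\Upsilon_{jik}$. A pair $(\nabla,\tilde\nabla)$ is canonical with respect to $g$ and $\Upsilon_{ijk}$ if (i) compatibility: $\partial_kg_{ij}=\Gamma_{kij}+\tilde\Gamma_{kji}$; (ii) torsion free: $\nabla_iE_j=\nabla_jE_i$ and $\tilde\nabla_i\tilde E_j=\tilde\nabla_j\tilde E_i$; (iii) chirality: $\Gamma_{ijk}-\tilde\Gamma_{ijk}=\Upsilon_{ijk}$. Curvatures: $\mathcal{R}_{E_iE_j}=\nabla_i\nabla_j-\nabla_j\nabla_i$ on $\mathcal{T}_U$, $R_{lkij}=g(\mathcal{R}_{E_iE_j}E_k,\tilde E_l)$, $R_{kj}=R_{lkij}*g^{li}$, $\Theta_{il}=g^{jk}*R_{lkij}$, $R^p_j=g^{pk}*R_{lkij}*g^{li}$, $\Theta^p_i=g^{jk}*R_{lkij}*g^{lp}$. *)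

(* Defs.v *)
From HB Require Import structures.
From mathcomp Require Import all_boot all_order all_algebra.
From mathcomp Require Import all_classical all_reals all_analysis.

Set Implicit Arguments.
Unset Strict Implicit.
Unset Printing Implicit Defensive.

Import Order.TTheory GRing.Theory Num.Theory.
Import numFieldNormedType.Exports.

Local Open Scope classical_set_scope.
Local Open Scope ring_scope.

Section SmoothOnRn.
Variables (R : realType) (n : nat).
Implicit Types (W : set 'rV[R]_n) (F G : 'rV[R]_n -> R).

Definition partial F (j : 'I_n) : 'rV[R]_n -> R :=
  fun y => 'D_(delta_mx 0 j) F y.

Fixpoint Ck W (k : nat) F : Prop :=
  (forall y, W y -> {for y, continuous F}) /\
  (if k is k'.+1 then
     forall j, (forall y, W y -> derivable F y (delta_mx 0 j)) /\
               Ck W k' (partial F j)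
   else True).

Definition smooth_on W F : Prop := forall k, Ck W k F.

Lemma CkW W k F : Ck W k.+1 F -> Ck W k F.
Proof.
elim: k F => [|k IH] F [cF dF]; split => // j.
by have [? ?] := dF j; split => //; exact: IH.
Qed.

Lemma Ck_eq W k F G : open W -> (forall y, W y -> F y = G y) ->
  Ck W k F -> Ck W k G.
Proof.
move=> oW.
have nearW (H K : 'rV[R]_n -> R) y : (forall y, W y -> H y = K y) -> W y ->
    \near y, H y = K y.
  by move=> HK Wy; near=> z; apply: HK; near: z; exact: open_nbhs_nbhs.
have contW (H K : 'rV[R]_n -> R) y : (forall y, W y -> H y = K y) -> W y ->
    {for y, continuous H} -> {for y, continuous K}.
  move=> HK Wy; rewrite /prop_for /continuous_at -(HK y Wy); apply: cvg_trans.
  by apply: (@near_eq_cvg _ _ (nbhs y)); exact: nearW.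
elim: k F G => [|k IH] F G FG [cF dF]; split => //.
- by move=> y Wy; exact: contW FG Wy (cF y Wy).
- by move=> y Wy; exact: contW FG Wy (cF y Wy).
- move=> j; have [dj cj] := dF j; split.
    by move=> y Wy; apply: near_eq_derivable (dj y Wy); exact: nearW.
  apply: IH cj => y Wy; rewrite /partial.
  by apply: near_eq_derive; exact: nearW.
Unshelve. all: by end_near. Qed.

Lemma Ck_cst W k (a : R) : Ck W k (cst a).
Proof.
elim: k a => [|k IH] a; split => //; try by move=> y _; exact: cst_continuous.
move=> j; split; first by move=> y _; exact: derivable_cst.
rewrite (_ : partial _ _ = cst 0); first exact: IH.
by apply/funext => y; rewrite /partial derive_cst.
Qed.

Lemma CkD W k F G : open W -> Ck W k F -> Ck W k G -> Ck W k (F + G).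
Proof.
move=> oW; elim: k F G => [|k IH] F G [cF dF] [cG dG]; split => //;
  try by move=> y Wy; apply: continuousD; [exact: cF|exact: cG].
move=> j; have [dFj cFj] := dF j; have [dGj cGj] := dG j; split.
  by move=> y Wy; apply: derivableD; [exact: dFj|exact: dGj].
apply: (Ck_eq oW _ (IH _ _ cFj cGj)) => y Wy.
by rewrite /partial deriveD; [|exact: dFj|exact: dGj].
Qed.

Lemma CkM W k F G : open W -> Ck W k F -> Ck W k G -> Ck W k (F * G).
Proof.
move=> oW; elim: k F G => [|k IH] F G hF hG; have [cF dF] := hF;
  have [cG dG] := hG; split => //;
  try by move=> y Wy; apply: continuousM; [exact: cF|exact: cG].
move=> j; have [dFj cFj] := dF j; have [dGj cGj] := dG j; split.
  by move=> y Wy; apply: derivableM; [exact: dFj|exact: dGj].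
apply: (Ck_eq oW _ (CkD oW (IH _ _ (CkW hF) cGj) (IH _ _ (CkW hG) cFj))).
by move=> y Wy; rewrite /partial deriveM; [|exact: dFj|exact: dGj].
Qed.

End SmoothOnRn.

Section Charts.
Variables (R : realType) (n : nat).

(* The coordinate map is total on M, but its values outside the domain are
   irrelevant. *)
Record chart (M : topologicalType) := Chart {
  chart_dom :> set M;
  coord : M -> 'rV[R]_n;
  chart_dom_open : open chart_dom;
  coord_inj : forall p q, chart_dom p -> chart_dom q ->
    coord p = coord q -> p = q;
  coord_continuous : forall p, chart_dom p -> {for p, continuous coord};
  coord_open : forall V : set M, open V -> V `<=` chart_dom ->
    open (coord @` V) }.

(* The function f o x^-1 on x(c), extended by 0 to R^n. *)
Definition local_rep (M : topologicalType) (c : chart M) (f : c -> R) :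
    'rV[R]_n -> R :=
  fun y => if pselect (exists p : c, coord c (val p) = y) is left e
           then f (projT1 (cid e)) else 0.

Definition smooth_transition (M : topologicalType) (a b : chart M) : Prop :=
  forall j : 'I_n,
    smooth_on (coord a @` (a `&` b))
      (local_rep (fun p : a => coord b (val p) 0 j)).

Definition compatible (M : topologicalType) (a b : chart M) : Prop :=
  smooth_transition a b /\ smooth_transition b a.

Record smooth_manifold := SmoothManifold {
  manifold_space :> topologicalType;
  atlas : set (chart manifold_space);
  manifold_hausdorff : hausdorff_space manifold_space;
  manifold_second_countable : @second_countable manifold_space;
  atlas_cover : forall p : manifold_space, exists2 c, atlas c & chart_dom c p;
  atlas_compatible : forall a b, atlas a -> atlas b -> compatible a b }.

(* Membership in the maximal atlas. *)
Definition coordinate_chart (M : smooth_manifold) (c : chart M) : Prop :=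
  forall a, atlas a -> compatible a c.

End Charts.

Section SmoothFunctions.
Variables (R : realType) (n : nat) (M : topologicalType) (U : chart R n M).
Implicit Types f g : U -> R.

Definition coord_image : set 'rV[R]_n := coord U @` U.

Lemma coord_image_open : open coord_image.
Proof. exact: coord_open (chart_dom_open U) _. Qed.

Lemma coord_imageP (p : U) : coord_image (coord U (val p)).
Proof. by exists (val p) => //; exact: set_valP. Qed.

Lemma local_repE f (p : U) : local_rep f (coord U (val p)) = f p.
Proof.
rewrite /local_rep; case: pselect => [e|[]]; last by exists p.
congr f; apply: val_inj; apply: (@coord_inj _ _ _ U);
  [exact: set_valP|exact: set_valP|exact: projT2 (cid e)].
Qed.

Lemma local_repD f g : local_rep (f + g) = local_rep f + local_rep g.
Proof.
apply/funext => y; rewrite /local_rep !fctE.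
by case: pselect => //= _; rewrite addr0.
Qed.

Lemma local_repM f g : local_rep (f * g) = local_rep f * local_rep g.
Proof.
apply/funext => y; rewrite /local_rep !fctE.
by case: pselect => //= _; rewrite mulr0.
Qed.

Lemma local_repZ (a : R) f : local_rep (a *: f) = cst a * local_rep f.
Proof.
apply/funext => y; rewrite /local_rep !fctE.
by case: pselect => //= _; rewrite mulr0.
Qed.

Definition smooth : {pred U -> R} :=
  fun f => `[< smooth_on coord_image (local_rep f) >].

Lemma smoothP f : reflect (smooth_on coord_image (local_rep f)) (f \in smooth).
Proof. exact: asboolP. Qed.

Lemma smooth_onE f F : smooth_on coord_image F ->
  (forall p : U, F (coord U (val p)) = f p) -> f \in smooth.
Proof.
move=> sF Ff; apply/smoothP => k; apply: (Ck_eq coord_image_open _ (sF k)).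
move=> _ [p Up <-].
by rewrite -[p]/(val (SigSub (mem_set Up) : U)) local_repE Ff.
Qed.

Lemma smooth_cst (a : R) : (cst a : U -> R) \in smooth.
Proof. by apply: (@smooth_onE _ (cst a)) => // k; exact: Ck_cst. Qed.

Lemma smoothD f g : f \in smooth -> g \in smooth -> f + g \in smooth.
Proof.
move=> /smoothP sf /smoothP sg; apply/smoothP => k; rewrite local_repD.
by apply: CkD => //; exact: coord_image_open.
Qed.

Lemma smoothM f g : f \in smooth -> g \in smooth -> f * g \in smooth.
Proof.
move=> /smoothP sf /smoothP sg; apply/smoothP => k; rewrite local_repM.
by apply: CkM => //; exact: coord_image_open.
Qed.

Lemma smoothZ (a : R) f : f \in smooth -> a *: f \in smooth.
Proof.
move=> /smoothP sf; apply/smoothP => k; rewrite local_repZ.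
by apply: CkM => //; [exact: coord_image_open|exact: Ck_cst].
Qed.

Lemma smoothB f g : f \in smooth -> g \in smooth -> f - g \in smooth.
Proof. by move=> sf sg; rewrite -(scaleN1r g) smoothD// smoothZ. Qed.

Fact smooth_subring : subring_closed smooth.
Proof.
by split; [exact: smooth_cst 1|exact: smoothB|exact: smoothM].
Qed.

HB.instance Definition _ :=
  GRing.isSubringClosed.Build (U -> R) smooth smooth_subring.

Fact smooth_scale : scaler_closed smooth.
Proof. by move=> a f; exact: smoothZ. Qed.

HB.instance Definition _ :=
  GRing.isScaleClosed.Build R (U -> R) smooth smooth_scale.

Record Cinf := MkCinf { cinf_fun :> U -> R; cinf_smooth : cinf_fun \in smooth }.

HB.instance Definition _ := [isSub for cinf_fun].
HB.instance Definition _ := [Choice of Cinf by <:].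
HB.instance Definition _ :=
  GRing.SubChoice_isSubComPzRing.Build (U -> R) smooth Cinf smooth_subring.
HB.instance Definition _ := [SubZmodule_isSubLmodule of Cinf by <:].

(* The coordinate vector field d/dx^j acting on functions on U. *)
Definition pd_fun (j : 'I_n) f : U -> R :=
  fun p => partial (local_rep f) j (coord U (val p)).

Fact pd_smooth j (f : Cinf) : pd_fun j f \in smooth.
Proof.
apply: (@smooth_onE _ (partial (local_rep f) j)) => // k.
by have /smoothP/(_ k.+1)[_ /(_ j)[]] := cinf_smooth f.
Qed.

Definition pd j (f : Cinf) : Cinf := MkCinf (pd_smooth j f).

Lemma smooth_derivable f j (p : U) : f \in smooth ->
  derivable (local_rep f) (coord U (val p)) (delta_mx 0 j).
Proof.
by move=> /smoothP/(_ 1%N)[_ /(_ j)[d _]]; apply: d; exact: coord_imageP.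
Qed.

Lemma pd_funD j f g : f \in smooth -> g \in smooth ->
  pd_fun j (f + g) = pd_fun j f + pd_fun j g.
Proof.
move=> sf sg; apply/funext => p; rewrite /pd_fun /partial local_repD.
by rewrite deriveD//; exact: smooth_derivable.
Qed.

Lemma pd_funZ j (a : R) f : f \in smooth ->
  pd_fun j (a *: f) = a *: pd_fun j f.
Proof.
move=> sf; apply/funext => p; rewrite /pd_fun /partial local_repZ.
rewrite (_ : cst a * _ = a \*: local_rep f) // deriveZ//.
exact: smooth_derivable.
Qed.

Lemma pd_fun0 j : pd_fun j 0 = 0.
Proof. by rewrite -(scale0r 0) pd_funZ ?scale0r// rpred0. Qed.

Lemma pd_fun_sum j (I : Type) (s : seq I) (F : I -> U -> R) :
  (forall i, F i \in smooth) ->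
  pd_fun j (\sum_(i <- s) F i) = \sum_(i <- s) pd_fun j (F i).
Proof.
move=> sF; elim: s => [|i s IH]; first by rewrite !big_nil pd_fun0.
by rewrite !big_cons pd_funD ?IH// rpred_sum.
Qed.

End SmoothFunctions.

Section MoyalProduct.
Variables (R : realType) (n : nat) (M : topologicalType) (U : chart R n M).
Variable theta : 'M[R]_n.

(* theta^{ij} d_i d'_j acting on functions of (x, x') in U x U. *)
Definition bidiff (F : U -> U -> R) : U -> U -> R :=
  fun x x' => \sum_i \sum_j
    theta i j * pd_fun i (fun y => pd_fun j (F y) x') x.

Definition moyal_fun (q : nat) (u v : U -> R) : U -> R :=
  fun x => (q`!%:R)^-1 * iter q bidiff (fun x x' => u x * v x') x x.

Lemma iter_bidiffE q (u v : Cinf U) : exists s : seq (Cinf U * Cinf U),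
  forall x x', iter q bidiff (fun x x' => u x * v x') x x' =
    \sum_(w <- s) w.1 x * w.2 x'.
Proof.
elim: q => [|q [s IH]]; first by exists [:: (u, v)] => x x'; rewrite big_seq1.
exists [seq (theta ijw.1.1 ijw.1.2 *: pd ijw.1.1 ijw.2.1, pd ijw.1.2 ijw.2.2)
       | ijw <- [seq (ij, w) | ij <- enum {: 'I_n * 'I_n}, w <- s]].
move=> x x' /=.
have -> : iter q bidiff (fun x x' => u x * v x') =
    fun x x' => \sum_(w <- s) w.1 x * w.2 x'.
  by apply/funext => y; apply/funext => y'; exact: IH.
rewrite big_map big_allpairs_dep /= big_enum /=.
rewrite -(pair_bigA _ (fun i j => \sum_(w <- s)
  (theta i j *: pd i w.1) x * (pd j w.2) x')) /=.
apply: eq_bigr => i _; apply: eq_bigr => j _.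
have -> : (fun y => pd_fun j (fun y' => \sum_(w <- s) w.1 y * w.2 y') x') =
    \sum_(w <- s) (pd j w.2 x' *: (w.1 : U -> R)).
  apply/funext => y.
  have -> : (fun y' => \sum_(w <- s) w.1 y * w.2 y') =
      \sum_(w <- s) (w.1 y *: (w.2 : U -> R)) by rewrite fct_sumE.
  rewrite pd_fun_sum; last by move=> w; rewrite rpredZ// cinf_smooth.
  rewrite !fct_sumE; apply: eq_bigr => w _.
  by rewrite pd_funZ ?cinf_smooth//; exact: mulrC.
rewrite pd_fun_sum; last by move=> w; rewrite rpredZ// cinf_smooth.
rewrite fct_sumE mulr_sumr; apply: eq_bigr => w _.
rewrite pd_funZ ?cinf_smooth//.
transitivity (theta i j * (pd_fun j w.2 x' * pd_fun i w.1 x)) => //.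
by rewrite [X in _ * X]mulrC mulrA.
Qed.

Fact moyal_smooth q (u v : Cinf U) : moyal_fun q u v \in @smooth R n M U.
Proof.
have [s E] := iter_bidiffE q u v.
have -> : moyal_fun q u v =
    (q`!%:R)^-1 *: \sum_(w <- s) (w.1 : U -> R) * (w.2 : U -> R).
  apply/funext => x; rewrite /moyal_fun E.
  by rewrite -[RHS]/(_ * _) fct_sumE.
by rewrite rpredZ// rpred_sum// => w _; rewrite rpredM// cinf_smooth.
Qed.

(* The coefficient of hbar^q in u * v = exp(hbar theta^{ij} d_i d'_j) u v. *)
Definition moyal q (u v : Cinf U) : Cinf U := MkCinf (moyal_smooth q u v).

End MoyalProduct.

Section PowerSeries.
Variables (R : realType) (n : nat) (M : topologicalType) (U : chart R n M).

(* C^oo(U)[[hbar]], a series h being the sequence of its coefficients h q. *)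
Definition ncs : Type := nat -> Cinf U.
HB.instance Definition _ := GRing.Zmodule.on ncs.

(* The unit series.  It is not the (pointwise) unit of the function space. *)
Definition nc1 : ncs := fun q => if q == 0%N then 1 else 0.

Definition nc_delta (i j : 'I_n) : ncs := if i == j then nc1 else 0.

Definition nc_pd (i : 'I_n) (h : ncs) : ncs := fun q => pd i (h q).

(* The action of a scalar series a in R[[hbar]]. *)
Definition hscale (a : nat -> R) (h : ncs) : ncs :=
  fun q => \sum_(r < q.+1) a r *: h (q - r)%N.

Definition star (theta : 'M[R]_n) (h k : ncs) : ncs :=
  fun q => \sum_(a < q.+1) \sum_(b < (q - a).+1)
    moyal theta (q - a - b) (h a) (k b).

End PowerSeries.

Section Geometry.
Variables (R : realType) (n : nat) (M : topologicalType) (U : chart R n M).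
Variable theta : 'M[R]_n.

Local Notation A := (ncs U).
Local Notation "h ⋆ k" := (star theta h k) (at level 40, left associativity).

(* The free left module: V stands for V^k * E_k. *)
Definition lvec : Type := 'I_n -> A.
HB.instance Definition _ := GRing.Zmodule.on lvec.

(* The free right module: W stands for E~_k * W^k. *)
Definition rvec : Type := 'I_n -> A.
HB.instance Definition _ := GRing.Zmodule.on rvec.

Definition lbasis (i : 'I_n) : lvec := fun k => nc_delta U i k.
Definition rbasis (i : 'I_n) : rvec := fun k => nc_delta U i k.

Definition lact (f : A) (V : lvec) : lvec := fun k => f ⋆ V k.
Definition ract (W : rvec) (f : A) : rvec := fun k => W k ⋆ f.

Definition lhscale (a : nat -> R) (V : lvec) : lvec := fun k => hscale a (V k).
Definition rhscale (a : nat -> R) (W : rvec) : rvec := fun k => hscale a (W k).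

Definition inverse_matrix (g ginv : 'I_n -> 'I_n -> A) : Prop :=
  forall i j,
    \sum_k g i k ⋆ ginv k j = nc_delta U i j /\
    \sum_k ginv j k ⋆ g k i = nc_delta U i j.

(* A two-sided module map on the tensor product over R[[hbar]] is given as
   the corresponding R[[hbar]]-bilinear map. *)
Record nc_metric := NCMetric {
  metric_fun :> lvec -> rvec -> A;
  metricDl : forall V V' W,
    metric_fun (V + V') W = metric_fun V W + metric_fun V' W;
  metricDr : forall V W W',
    metric_fun V (W + W') = metric_fun V W + metric_fun V W';
  metric_hscalel : forall a V W,
    metric_fun (lhscale a V) W = hscale a (metric_fun V W);
  metric_hscaler : forall a V W,
    metric_fun V (rhscale a W) = hscale a (metric_fun V W);
  metric_lact : forall f V W, metric_fun (lact f V) W = f ⋆ metric_fun V W;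
  metric_ract : forall V W f, metric_fun V (ract W f) = metric_fun V W ⋆ f;
  metric_invertible :
    exists! ginv : 'I_n -> 'I_n -> A,
      inverse_matrix (fun i j => metric_fun (lbasis i) (rbasis j)) ginv }.

Record left_connection := LeftConnection {
  lnabla :> 'I_n -> lvec -> lvec;
  lnablaD : forall i V V', lnabla i (V + V') = lnabla i V + lnabla i V';
  lnabla_hscale : forall i a V, lnabla i (lhscale a V) = lhscale a (lnabla i V);
  lnabla_leibniz : forall i f V,
    lnabla i (lact f V) = lact (nc_pd i f) V + lact f (lnabla i V) }.

Record right_connection := RightConnection {
  rnabla :> 'I_n -> rvec -> rvec;
  rnablaD : forall i W W', rnabla i (W + W') = rnabla i W + rnabla i W';
  rnabla_hscale : forall i a W, rnabla i (rhscale a W) = rhscale a (rnabla i W);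
  rnabla_leibniz : forall i W f,
    rnabla i (ract W f) = ract W (nc_pd i f) + ract (rnabla i W) f }.

Definition chiral_coefficients (Ups : 'I_n -> 'I_n -> 'I_n -> A) : Prop :=
  forall i j k, Ups i j k = Ups j i k.

Section Curvature.
Variables (g : nc_metric) (D : left_connection) (Dt : right_connection).

Definition g_low (i j : 'I_n) : A := g (lbasis i) (rbasis j).

(* The matrix (g^{ij}), chosen from its unique existence. *)
Definition g_up : 'I_n -> 'I_n -> A := projT1 (cid (metric_invertible g)).

(* Gamma_{ij}^k and Gamma~_{ij}^k, with arguments in the order i, j, k. *)
Definition Gamma (i j k : 'I_n) : A := D i (lbasis j) k.
Definition Gammat (i j k : 'I_n) : A := Dt i (rbasis j) k.

(* Gamma_{ijk} and Gamma~_{ijk} *)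
Definition Gamma_low (i j k : 'I_n) : A := \sum_l Gamma i j l ⋆ g_low l k.
Definition Gammat_low (i j k : 'I_n) : A := \sum_l g_low k l ⋆ Gammat i j l.

Record canonical_connection (Ups : 'I_n -> 'I_n -> 'I_n -> A) : Prop := MkCanonical {
  compatibility : forall i j k,
    nc_pd k (g_low i j) = Gamma_low k i j + Gammat_low k j i;
  torsion_free_left : forall i j, D i (lbasis j) = D j (lbasis i);
  torsion_free_right : forall i j, Dt i (rbasis j) = Dt j (rbasis i);
  chirality : forall i j k, Gamma_low i j k - Gammat_low i j k = Ups i j k }.

Definition curvature (i j : 'I_n) (V : lvec) : lvec :=
  D i (D j V) - D j (D i V).

(* R_{lkij} *)
Definition riemann (l k i j : 'I_n) : A :=
  g (curvature i j (lbasis k)) (rbasis l).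

(* R_{kj} *)
Definition ricci (k j : 'I_n) : A :=
  \sum_l \sum_i riemann l k i j ⋆ g_up l i.

(* Theta_{il} *)
Definition ricci_theta (i l : 'I_n) : A :=
  \sum_j \sum_k g_up j k ⋆ riemann l k i j.

(* R^p_j *)
Definition ricci_mixed (p j : 'I_n) : A :=
  \sum_k \sum_l \sum_i g_up p k ⋆ riemann l k i j ⋆ g_up l i.

(* Theta^p_i *)
Definition ricci_theta_mixed (p i : 'I_n) : A :=
  \sum_j \sum_k \sum_l g_up j k ⋆ riemann l k i j ⋆ g_up l p.

End Curvature.
End Geometry.

(* Main.v *)
Require Import Defs.
From mathcomp Require Import all_boot all_order all_algebra.
From mathcomp Require Import all_classical all_reals all_analysis.
From mathcomp Require Import zify.

(* The reversal hbar -> - hbar is an anti-automorphism of the Moyal algebra,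
   since theta is skew, and it commutes with the d_i.  By hypothesis it
   transposes g and negates Upsilon.  As in the uniqueness proof for the
   Levi-Civita connection, it follows that it exchanges Gamma_{ijk} and
   Gamma~_{ijk}, and then Gamma_{ij}^k and Gamma~_{ij}^k.  In
     R_{lkij} = d_i Gamma_{jkl} - Gamma_{jk}^m * Gamma~_{ilm} - (i <-> j)
   compatibility and d_i d_j = d_j d_i then show that it sends R_{lkij} to
   R_{klji}; since it also transposes (g^{ij}), it exchanges the two Ricci
   curvatures. *)

Set Implicit Arguments.
Unset Strict Implicit.
Unset Printing Implicit Defensive.

Import Order.TTheory GRing.Theory Num.Theory.
Import numFieldNormedType.Exports.

Local Open Scope classical_set_scope.
Local Open Scope ring_scope.

(** * Symmetry of second directional derivatives *)

Section MixedPartials.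
Variables (R : realType) (V : normedModType R).
Implicit Types (F : V -> R) (u v y : V).

Lemma is_derive_line F y v s : derivable F (y + s *: v) v ->
  is_derive s 1 (fun t => F (y + t *: v)) ('D_v F (y + s *: v)).
Proof.
have E : (fun h => h^-1 *: (((fun t => F (y + t *: v)) \o shift s) (h *: 1)
      - F (y + s *: v))) =
    (fun h => h^-1 *: ((F \o shift (y + s *: v)) (h *: v) - F (y + s *: v))).
  apply/funext => h /=; congr (_ *: (F _ - _)).
  by rewrite [h *: 1]mulr1 scalerDl addrCA.
by move=> dF; split; rewrite /derivable /derive E.
Qed.

Lemma mean_value_line F y v h : 0 < h ->
  (forall t, 0 <= t <= h -> derivable F (y + t *: v) v) ->
  exists2 c, 0 <= c <= h & F (y + h *: v) - F y = 'D_v F (y + c *: v) * h.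
Proof.
move=> h0 dF.
have dG t : t \in `[0, h] ->
    is_derive t 1 (fun t => F (y + t *: v)) ('D_v F (y + t *: v)).
  by move=> th; apply: is_derive_line; apply: dF; rewrite in_itv in th.
have cG : {within `[0, h], continuous (fun t => F (y + t *: v))}.
  by apply: derivable_within_continuous => t /dG [].
have [c] := MVT_segment (ltW h0) (fun t th => dG t (subset_itv_oo_cc th)) cG.
rewrite in_itv /= => ch E; exists c => //.
by move: E; rewrite scale0r addr0 subr0.
Qed.

(** Two applications of the mean value theorem: along [u] to the increment [F (x + h *: v) - F x] as
    a function of [x], then along [v] to ['D_u F]. *)
Lemma second_difference F u v y h : 0 < h ->
  (forall s t, 0 <= s <= h -> 0 <= t <= h ->
    derivable F (y + t *: v + s *: u) u /\
    derivable ('D_u F) (y + s *: u + t *: v) v) ->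
  exists s t, [/\ 0 <= s <= h, 0 <= t <= h &
    F (y + h *: v + h *: u) - F (y + h *: u) - F (y + h *: v) + F y =
      'D_v ('D_u F) (y + s *: u + t *: v) * h ^+ 2].
Proof.
move=> h0 dF; have hh : 0 <= h <= h by rewrite lexx ltW.
have h00 : 0 <= (0 : R) <= h by rewrite lexx ltW.
pose G := F \o shift (h *: v) - F.
have GE x : G x = F (x + h *: v) - F x by [].
have dG t : 0 <= t <= h -> is_derive (y + t *: u) u G
    ('D_u F (y + t *: u + h *: v) - 'D_u F (y + t *: u)).
  move=> th.
  have [dF1 _] := dF t h th hh; have [dF2 _] := dF t 0 th h00.
  have E : (fun k => k^-1 *: ((F \o shift (h *: v) \o shift (y + t *: u)) (k *: u)
      - (F \o shift (h *: v)) (y + t *: u))) =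
      (fun k => k^-1 *: ((F \o shift (y + h *: v + t *: u)) (k *: u)
      - F (y + h *: v + t *: u))).
    apply/funext => k /=; rewrite /shift /=.
    by rewrite -[in LHS](addrA (k *: u)) (addrAC y (t *: u)).
  have -> : 'D_u F (y + t *: u + h *: v) = 'D_u (F \o shift (h *: v)) (y + t *: u).
    by rewrite [RHS]/derive E addrAC.
  have D1 : derivable (F \o shift (h *: v)) (y + t *: u) u.
    by rewrite /derivable E; exact: dF1.
  have D2 : derivable F (y + t *: u) u.
    by move: dF2; rewrite scale0r addr0.
  by split; [exact: derivableB|exact: deriveB].
have [s sh Es] := @mean_value_line G y u h h0 (fun t th => @ex_derive _ _ _ _ _ _ _ (dG t th)).
have [t th Et] := @mean_value_line ('D_u F) (y + s *: u) v h h0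
  (fun t th => (dF s t sh th).2).
exists s, t; split => //.
move: Es; rewrite (@derive_val _ _ _ _ _ _ _ (dG s sh)) Et !GE => Es.
by rewrite expr2 mulrA -Es [y + _ + _]addrAC opprB [RHS]addrA [RHS]addrAC.
Qed.

(** Schwarz's argument: the second difference is symmetric in [u] and [v], so each mixed derivative
    takes the same value at some point near [y]; continuity carries this to [y] itself. *)
Lemma derive_commute F u v y :
  (\forall z \near y, [/\ derivable F z u, derivable F z v,
     derivable ('D_u F) z v & derivable ('D_v F) z u]) ->
  {for y, continuous ('D_v ('D_u F))} -> {for y, continuous ('D_u ('D_v F))} ->
  'D_v ('D_u F) y = 'D_u ('D_v F) y.
Proof.
move=> dF cvu cuv; apply/eqP; rewrite -subr_eq0 -normr_le0; apply/ler_addgt0Pr => e e0.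
have e2 : 0 < e / 2 by rewrite divr_gt0.
move/cvgrPdist_lt/(_ _ e2) : cvu => cvu.
move/cvgrPdist_lt/(_ _ e2) : cuv => cuv.
have [r /= r0 Hr] := (nbhs_ballP y _).1 (filterI dF (filterI cvu cuv)).
(* This [h] keeps every [y + s *: u + t *: v] with [s], [t] between 0 and [h] inside the ball; the
   summand 1 makes the denominator positive and the estimate strict. *)
pose h := r / (`|u| + `|v| + 1).
have d0 : 0 < `|u| + `|v| + 1 by rewrite ltr_wpDl // addr_ge0.
have h0 : 0 < h by rewrite divr_gt0.
have inr s t : 0 <= s <= h -> 0 <= t <= h -> ball y r (y + s *: u + t *: v).
  move=> /andP[s0 sh] /andP[t0 th]; rewrite -ball_normE /= -addrA opprD addrA subrr sub0r normrN.
  rewrite (le_lt_trans (ler_normD _ _)) // !normrZ (ger0_norm s0) (ger0_norm t0).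
  have : s * `|u| + t * `|v| <= h * `|u| + h * `|v|.
    by rewrite lerD // ler_wpM2r.
  move/le_lt_trans; apply; rewrite -mulrDr.
  have -> : r = h * (`|u| + `|v| + 1) by rewrite /h divfK // gt_eqF.
  by rewrite ltr_pM2l // ltrDl.
have [s [t [sh th E1]]] : exists s t, [/\ 0 <= s <= h, 0 <= t <= h &
    F (y + h *: v + h *: u) - F (y + h *: u) - F (y + h *: v) + F y =
      'D_v ('D_u F) (y + s *: u + t *: v) * h ^+ 2].
  apply: second_difference => // s t sh th.
  have [[d1 _ d3 _] _] := Hr _ (inr s t sh th).
  by split; [rewrite addrAC; exact: d1|exact: d3].
have [t' [s' [th' sh' E2]]] : exists t s, [/\ 0 <= t <= h, 0 <= s <= h &
    F (y + h *: u + h *: v) - F (y + h *: v) - F (y + h *: u) + F y =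
      'D_u ('D_v F) (y + t *: v + s *: u) * h ^+ 2].
  apply: second_difference => // t' s' th' sh'.
  have [[_ d2 _ d4] _] := Hr _ (inr s' t' sh' th').
  by split; [exact: d2|rewrite addrAC; exact: d4].
have E : 'D_v ('D_u F) (y + s *: u + t *: v) = 'D_u ('D_v F) (y + s' *: u + t' *: v).
  apply: (@mulIf _ (h ^+ 2)); first by rewrite expf_neq0 // gt_eqF.
  apply: (etrans (esym E1)).
  rewrite (addrAC y (s' *: u)).
  apply: etrans E2.
  rewrite (addrAC y (h *: u)).
  by rewrite (addrAC (F _)).
have [_ [A1 _]] := Hr _ (inr s t sh th).
have [_ [_ A2]] := Hr _ (inr s' t' sh' th').
move: A1 A2; rewrite /= E.
move: ('D_v _ y) ('D_u _ y) ('D_u _ _) => a b c A1 A2.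
(* Here [c] is the common value of the two mixed derivatives at the intermediate points, within
   [e / 2] of both [a] and [b]. *)
rewrite add0r (_ : a - b = (a - c) - (b - c)); last by rewrite opprB addrA subrK.
by apply: (le_trans (ler_normB _ _)); rewrite (splitr e); exact: ltW (ltrD A1 A2).
Qed.

End MixedPartials.

(** * The coordinate derivatives as commuting derivations of the smooth functions on U *)

Section Derivations.
Variables (R : realType) (n : nat) (M : topologicalType) (U : chart R n M).
Implicit Types u v w : Cinf U.

Lemma CinfP u v : (forall x, u x = v x) -> u = v.
Proof. by move=> E; apply/val_inj/funext. Qed.

Lemma CinfME u v x : (u * v) x = u x * v x. Proof. by []. Qed.
Lemma CinfZE a u x : (a *: u) x = a * u x. Proof. by []. Qed.

Lemma Cinf_sumE (I : Type) (s : seq I) (P : pred I) (F : I -> Cinf U) x :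
  (\sum_(i <- s | P i) F i) x = \sum_(i <- s | P i) F i x.
Proof.
by apply: (big_morph (fun u : Cinf U => u x)).
Qed.

Lemma CinfZAl a u v : (a *: u) * v = a *: (u * v).
Proof. by apply: CinfP => x; rewrite !(CinfME, CinfZE) mulrA. Qed.

Lemma CinfZAr a u v : u * (a *: v) = a *: (u * v).
Proof. by apply: CinfP => x; rewrite !(CinfME, CinfZE) mulrCA. Qed.

Lemma pdD j u v : pd j (u + v) = pd j u + pd j v.
Proof. by apply/val_inj; exact: pd_funD (cinf_smooth u) (cinf_smooth v). Qed.

Lemma pdZ j a u : pd j (a *: u) = a *: pd j u.
Proof. by apply/val_inj; exact: pd_funZ (cinf_smooth u). Qed.

Lemma pdM j u v : pd j (u * v) = pd j u * v + u * pd j v.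
Proof.
apply: CinfP => x; rewrite /= /pd_fun /partial.
rewrite [X in local_rep X](_ : _ = (u : U -> R) * v) //.
rewrite local_repM deriveM; [|exact: smooth_derivable (cinf_smooth _)..].
by rewrite !local_repE addrC [X in X + _ = _]mulrC.
Qed.

(** The local representative of [pd l u] is extended by 0 and agrees with the partial derivative of
    that of [u] only on the coordinate image. That image is open, so a further derivative at its
    points sees no difference, and [derive_commute] applies. *)
Lemma pd_comm i j u : pd i (pd j u) = pd j (pd i u).
Proof.
have D k l (x : U) : pd k (pd l u) x =
    partial (partial (local_rep u) l) k (Defs.coord U (val x)).
  rewrite /= /pd_fun /partial; apply: near_eq_derive.
  near=> y.
  have [p Up <-] : coord_image U y.
    near: y; apply: open_nbhs_nbhs; split; first exact: coord_image_open.
    exact: coord_imageP.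
  by rewrite -[p]/(val (SigSub (mem_set Up) : U)) local_repE.
apply: CinfP => x; rewrite !D.
have /smoothP/(_ 2%N) [_ C] := cinf_smooth u.
have [di [_ ci]] := C i; have [dj [_ cj]] := C j.
have [dij ] := ci j; have [dji] := cj i.
move=> [cji _] [cij _].
apply: derive_commute; last 2 first.
- exact: cji (coord_imageP x).
- exact: cij (coord_imageP x).
near=> y.
have Wy : coord_image U y.
  near: y; apply: open_nbhs_nbhs; split; first exact: coord_image_open.
  exact: coord_imageP.
by split; [exact: dj|exact: di|exact: dji|exact: dij].
Unshelve. all: by end_near. Qed.

Lemma pd1 j : pd j (1 : Cinf U) = 0.
Proof.
have := pdM j (1 : Cinf U) 1; rewrite !mulr1 mul1r => E.
by apply: (addrI (pd j 1)); rewrite addr0 -E.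
Qed.

Lemma pd0 j : pd j (0 : Cinf U) = 0.
Proof. by have := pdZ j 0 (0 : Cinf U); rewrite !scale0r. Qed.

Lemma pd_sum j (I : Type) (s : seq I) (P : pred I) (F : I -> Cinf U) :
  pd j (\sum_(i <- s | P i) F i) = \sum_(i <- s | P i) pd j (F i).
Proof. by apply: (big_morph (pd j)); [exact: pdD|exact: pd0]. Qed.

End Derivations.


(** * Coefficients of the Moyal product: recursion, exchange of factors, associativity *)

Section Moyal.
Variables (R : realType) (n : nat) (M : topologicalType) (U : chart R n M).
Variable theta : 'M[R]_n.
Implicit Types (u v : Cinf U) (s : seq (Cinf U * Cinf U)).
Local Notation moyal := (@moyal R n M U theta).

(** A list of pairs encodes a finite sum of elementary tensors; on these [bidiff] becomes the list
    operation [bidiff_terms], which can be iterated and split term by term. *)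
Let tensor s : U -> U -> R := fun x x' => \sum_(w <- s) w.1 x * w.2 x'.

Let bidiff_terms s := flatten [seq
  [seq (theta ij.1 ij.2 *: pd ij.1 w.1, pd ij.2 w.2) | ij <- enum {: 'I_n * 'I_n}]
  | w <- s].

Let bidiff_tensor s : bidiff theta (tensor s) = tensor (bidiff_terms s).
Proof.
apply/funext => x; apply/funext => x'; rewrite /bidiff /tensor.
rewrite big_flatten /= big_map.
under [RHS]eq_bigr do rewrite big_map /= big_enum /=.
rewrite [RHS]exchange_big /= -(pair_bigA _ (fun i j => \sum_(w <- s)
  (theta i j *: pd i w.1) x * (pd j w.2) x')) /=.
apply: eq_bigr => i _; apply: eq_bigr => j _.
have -> : (fun y => pd_fun j (fun y' => \sum_(w <- s) w.1 y * w.2 y') x') =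
    \sum_(w <- s) (pd j w.2 x' *: (w.1 : U -> R)).
  apply/funext => y.
  have -> : (fun y' => \sum_(w <- s) w.1 y * w.2 y') =
      \sum_(w <- s) (w.1 y *: (w.2 : U -> R)) by rewrite fct_sumE.
  rewrite pd_fun_sum; last by move=> w; rewrite rpredZ// cinf_smooth.
  rewrite !fct_sumE; apply: eq_bigr => w _.
  by rewrite pd_funZ ?cinf_smooth//; exact: mulrC.
rewrite pd_fun_sum; last by move=> w; rewrite rpredZ// cinf_smooth.
rewrite fct_sumE mulr_sumr; apply: eq_bigr => w _.
rewrite pd_funZ ?cinf_smooth//.
transitivity (theta i j * (pd_fun j w.2 x' * pd_fun i w.1 x)) => //.
by rewrite [X in _ * X]mulrC mulrA.
Qed.

Let iter_bidiff_tensor q s :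
  iter q (bidiff theta) (tensor s) = tensor (iter q bidiff_terms s).
Proof. by elim: q => //= q ->; rewrite bidiff_tensor. Qed.

Let iter_bidiff_terms q s : iter q bidiff_terms s =
  flatten [seq iter q bidiff_terms [:: w] | w <- s].
Proof.
elim: q => [|q IH] /=; first by elim: s => //= w s {1}->.
rewrite {}IH; elim: s => //= w s <-.
by rewrite {1}/bidiff_terms map_cat flatten_cat.
Qed.

Let moyal_termsE q u v : moyal q u v = (q`!%:R)^-1 *:
  \sum_(w <- iter q bidiff_terms [:: (u, v)]) w.1 * w.2.
Proof.
apply: CinfP => x; rewrite CinfZE Cinf_sumE /= /moyal_fun.
have -> : (fun x x' => u x * v x') = tensor [:: (u, v)].
  by apply/funext => y; apply/funext => y'; rewrite /tensor big_seq1.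
by rewrite iter_bidiff_tensor.
Qed.

Lemma moyal0 u v : moyal 0 u v = u * v.
Proof. by rewrite moyal_termsE fact0 invr1 scale1r big_seq1. Qed.

(** The innermost application of [bidiff] is peeled off, and [q.+1] cancels against the factorial.
    The algebraic laws below follow from this recursion by induction on [q]. *)
Let moyal_rec q u v : q.+1%:R *: moyal q.+1 u v =
  \sum_i \sum_j moyal q (theta i j *: pd i u) (pd j v).
Proof.
have E : bidiff_terms [:: (u, v)] =
    [seq (theta ij.1 ij.2 *: pd ij.1 u, pd ij.2 v) | ij <- enum {: 'I_n * 'I_n}].
  exact: cats0.
rewrite moyal_termsE iterSr E iter_bidiff_terms big_flatten big_map.
rewrite big_map big_enum /= scalerA factS natrM invfM mulrA.
rewrite divff ?pnatr_eq0// mul1r scaler_sumr.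
rewrite (pair_bigA _ (fun i j => moyal q (theta i j *: pd i u) (pd j v))) /=.
by apply: eq_bigr => -[i j] _; rewrite moyal_termsE.
Qed.

Let natS_scaleI q : injective (fun u : Cinf U => q.+1%:R *: u).
Proof. by apply: scalerI; rewrite pnatr_eq0. Qed.

Lemma moyalDl q u u' v : moyal q (u + u') v = moyal q u v + moyal q u' v.
Proof.
elim: q u u' v => [|q IH] u u' v; first by rewrite !moyal0 mulrDl.
apply: (@natS_scaleI q); rewrite scalerDr !moyal_rec -big_split.
apply: eq_bigr => i _; rewrite -big_split; apply: eq_bigr => j _.
by rewrite pdD scalerDr IH.
Qed.

Lemma moyalDr q u v v' : moyal q u (v + v') = moyal q u v + moyal q u v'.
Proof.
elim: q u v v' => [|q IH] u v v'; first by rewrite !moyal0 mulrDr.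
apply: (@natS_scaleI q); rewrite scalerDr !moyal_rec -big_split.
apply: eq_bigr => i _; rewrite -big_split; apply: eq_bigr => j _.
by rewrite pdD IH.
Qed.

Lemma moyalZl q a u v : moyal q (a *: u) v = a *: moyal q u v.
Proof.
elim: q u v => [|q IH] u v; first by rewrite !moyal0 CinfZAl.
apply: (@natS_scaleI q); rewrite scalerA mulrC -scalerA !moyal_rec scaler_sumr.
apply: eq_bigr => i _; rewrite scaler_sumr; apply: eq_bigr => j _.
by rewrite pdZ scalerA mulrC -scalerA IH.
Qed.

Lemma moyalZr q a u v : moyal q u (a *: v) = a *: moyal q u v.
Proof.
elim: q u v => [|q IH] u v; first by rewrite !moyal0 CinfZAr.
apply: (@natS_scaleI q); rewrite scalerA mulrC -scalerA !moyal_rec scaler_sumr.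
apply: eq_bigr => i _; rewrite scaler_sumr; apply: eq_bigr => j _.
by rewrite pdZ IH.
Qed.

(* Differentiate [exp (hbar theta^{ij} d_i d'_j)] in [hbar]. *)
Lemma moyalS q u v : q.+1%:R *: moyal q.+1 u v =
  \sum_i \sum_j theta i j *: moyal q (pd i u) (pd j v).
Proof.
rewrite moyal_rec; apply: eq_bigr => i _; apply: eq_bigr => j _.
by rewrite moyalZl.
Qed.

Lemma moyal0l q v : moyal q 0 v = 0.
Proof. by have := moyalZl q 0 0 v; rewrite !scale0r. Qed.

Lemma moyal0r q u : moyal q u 0 = 0.
Proof. by have := moyalZr q 0 u 0; rewrite !scale0r. Qed.

Lemma moyal_suml q (I : Type) (r : seq I) (P : pred I) (F : I -> Cinf U) v :
  moyal q (\sum_(i <- r | P i) F i) v = \sum_(i <- r | P i) moyal q (F i) v.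
Proof.
apply: (big_morph (fun u => moyal q u v)) => [u u'|]; first exact: moyalDl.
exact: moyal0l.
Qed.

Lemma moyal_sumr q (I : Type) (r : seq I) (P : pred I) (F : I -> Cinf U) u :
  moyal q u (\sum_(i <- r | P i) F i) = \sum_(i <- r | P i) moyal q u (F i).
Proof.
apply: (big_morph (moyal q u)) => [v v'|]; first exact: moyalDr.
exact: moyal0r.
Qed.

Lemma moyal1r q u : moyal q u 1 = if q == 0%N then u else 0.
Proof.
case: q => [|q]; first by rewrite moyal0 mulr1.
apply: (@natS_scaleI q); rewrite moyalS /= scaler0.
by rewrite big1 // => i _; rewrite big1 // => j _; rewrite pd1 moyal0r scaler0.
Qed.

Lemma moyal1l q v : moyal q 1 v = if q == 0%N then v else 0.
Proof.
case: q => [|q]; first by rewrite moyal0 mul1r.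
apply: (@natS_scaleI q); rewrite moyalS /= scaler0.
by rewrite big1 // => i _; rewrite big1 // => j _; rewrite pd1 moyal0l scaler0.
Qed.

(** The derivative passes through the recursion because it commutes with the other derivatives and
    [theta] is constant; in degree 0 it is the ordinary Leibniz rule. *)
Lemma pd_moyal k q u v :
  pd k (moyal q u v) = moyal q (pd k u) v + moyal q u (pd k v).
Proof.
elim: q u v => [|q IH] u v; first by rewrite !moyal0 pdM.
apply: (@natS_scaleI q); rewrite -pdZ scalerDr !moyalS pd_sum -big_split.
apply: eq_bigr => i _; rewrite pd_sum -big_split; apply: eq_bigr => j _.
by rewrite /= pdZ IH scalerDr (pd_comm k) (pd_comm k j).
Qed.

(** Exchanging the summation indices transposes [theta], which costs one sign for each degree. *)
Lemma moyalC q u v : theta^T = - theta ->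
  moyal q v u = (-1) ^+ q *: moyal q u v.
Proof.
move=> skew; elim: q u v => [|q IH] u v; first by rewrite !moyal0 scale1r mulrC.
apply: (@natS_scaleI q); rewrite scalerA mulrC -scalerA !moyalS exchange_big.
rewrite scaler_sumr; apply: eq_bigr => i _; rewrite scaler_sumr.
apply: eq_bigr => j _; rewrite IH !scalerA; congr (_ *: _).
have := congr1 (fun A : 'M[R]_n => A i j) skew; rewrite !mxE => ->.
by rewrite exprS mulN1r !mulNr mulrC.
Qed.

(** The degree [q] coefficients of the two bracketings of a triple product; [a] is the degree
    contributed by the outer product. *)
Let assocl q u v w := \sum_(a < q.+1) moyal a (moyal (q - a) u v) w.
Let assocr q u v w := \sum_(a < q.+1) moyal a u (moyal (q - a) v w).

(** Split [q.+1] as [a + (q.+1 - a)] in the term of index [a] and shift the index in the first part;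
    the end terms [a = 0] and [a = q.+1] drop out with coefficient 0. *)
Let assoc_step q (F : nat -> Cinf U) :
  q.+1%:R *: \sum_(a < q.+2) F a =
  \sum_(a < q.+1) (a.+1%:R *: F a.+1 + (q.+1 - a)%:R *: F a).
Proof.
have E (a : 'I_q.+2) :
    q.+1%:R *: F a = a%:R *: F a + (q.+1 - a)%:R *: F a.
  by rewrite -scalerDl -natrD subnKC // -ltnS.
rewrite scaler_sumr (eq_bigr _ (fun a _ => E a)) !big_split /=; congr (_ + _).
  by rewrite big_ord_recl scale0r add0r.
by rewrite big_ord_recr /= subnn scale0r addr0.
Qed.

(** The right side differentiates a triple exponential in which [theta] couples each of the pairs
    (u, v), (u, w) and (v, w). The inner product yields the first coupling; the outer one yields the
    other two through [pd_moyal]. *)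
Let assoclS q u v w : q.+1%:R *: assocl q.+1 u v w =
  \sum_i \sum_j theta i j *: (assocl q (pd i u) (pd j v) w +
    (assocl q (pd i u) v (pd j w) + assocl q u (pd i v) (pd j w))).
Proof.
rewrite /assocl (assoc_step q (fun a => moyal a (moyal (q.+1 - a) u v) w)).
transitivity (\sum_(a < q.+1) \sum_i \sum_j theta i j *: (
  moyal a (moyal (q - a) (pd i u) (pd j v)) w + (
  moyal a (moyal (q - a) (pd i u) v) (pd j w) +
  moyal a (moyal (q - a) u (pd i v)) (pd j w)))).
  apply: eq_bigr => a _; rewrite moyalS subSS subSn ?leq_ord// -moyalZl moyalS.
  rewrite moyal_suml -big_split; apply: eq_bigr => i _.
  rewrite moyal_suml -big_split; apply: eq_bigr => j _.
  by rewrite /= moyalZl -scalerDr pd_moyal moyalDl addrC.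
rewrite exchange_big; apply: eq_bigr => i _.
rewrite exchange_big; apply: eq_bigr => j _.
by rewrite -scaler_sumr !big_split.
Qed.

Let assocrS q u v w : q.+1%:R *: assocr q.+1 u v w =
  \sum_i \sum_j theta i j *: (assocr q (pd i u) (pd j v) w +
    (assocr q (pd i u) v (pd j w) + assocr q u (pd i v) (pd j w))).
Proof.
rewrite /assocr (assoc_step q (fun a => moyal a u (moyal (q.+1 - a) v w))).
transitivity (\sum_(a < q.+1) \sum_i \sum_j theta i j *: (
  moyal a (pd i u) (moyal (q - a) (pd j v) w) + (
  moyal a (pd i u) (moyal (q - a) v (pd j w)) +
  moyal a u (moyal (q - a) (pd i v) (pd j w))))).
  apply: eq_bigr => a _; rewrite moyalS subSS subSn ?leq_ord// -moyalZr moyalS.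
  rewrite moyal_sumr -big_split; apply: eq_bigr => i _.
  rewrite moyal_sumr -big_split; apply: eq_bigr => j _.
  by rewrite /= moyalZr -scalerDr pd_moyal moyalDr addrA.
rewrite exchange_big; apply: eq_bigr => i _.
rewrite exchange_big; apply: eq_bigr => j _.
by rewrite -scaler_sumr !big_split.
Qed.

(** Both bracketings obey the same recursion in [q] and equal the pointwise product for [q = 0]. *)
Lemma moyalA q u v w :
  \sum_(a < q.+1) moyal a (moyal (q - a) u v) w =
  \sum_(a < q.+1) moyal a u (moyal (q - a) v w).
Proof.
rewrite -/(assocl q u v w) -/(assocr q u v w).
elim: q u v w => [|q IH] u v w.
  by rewrite /assocl /assocr !big_ord1 !moyal0 mulrA.
apply: (@natS_scaleI q); rewrite assoclS assocrS.
by apply: eq_bigr => i _; apply: eq_bigr => j _; rewrite !IH.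
Qed.

End Moyal.

(** * Sums over a fixed box of degrees *)

Section BoundedSums.
Variable V : zmodType.

Lemma sum_ord_delta (N k : nat) (F : nat -> V) : (k < N)%N ->
  \sum_(p < N) F p *+ (p == k :> nat) = F k.
Proof.
move=> kN; rewrite (bigD1 (Ordinal kN)) //= eqxx mulr1n big1 ?addr0 // => p pk.
by rewrite (_ : (p == k :> nat) = false) //; apply: contra_neqF pk => /eqP pk; apply: val_inj.
Qed.

(** Trades ranges that depend on earlier indices for one common bound [N] and a 0-or-1 multiplicity
    that fixes the total degree, so that sums can be exchanged freely. *)
Lemma sum_antidiagonal (N q s : nat) (X : nat -> nat -> V) : (q < N)%N ->
  \sum_(d < N) \sum_(e < N) X d e *+ (s + d + e == q)%N =
  if (s <= q)%N then \sum_(d < (q - s).+1) X d (q - s - d)%N else 0.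
Proof.
move=> qN; case: ifP => sq; last first.
  rewrite big1 // => d _; rewrite big1 // => e _.
  by rewrite (_ : (_ == _) = false) //; lia.
have dN : ((q - s).+1 <= N)%N by lia.
rewrite [RHS](big_ord_widen N (fun d => X d (q - s - d)%N)) //.
rewrite [RHS]big_mkcond; apply: eq_bigr => d _; case: ifP => ds.
  rewrite -[RHS](sum_ord_delta (N := N) (X d)); last by lia.
  by apply: eq_bigr => e _; congr (_ *+ _); congr nat_of_bool; lia.
by rewrite big1 // => e _; rewrite (_ : (_ == _) = false) //; lia.
Qed.

End BoundedSums.

(** * The algebra of formal series under the star product *)

Section Star.
Variables (R : realType) (n : nat) (M : topologicalType) (U : chart R n M).
Variable theta : 'M[R]_n.
Implicit Types f g h : ncs U.

Local Notation moyal := (@moyal R n M U theta).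
Local Notation "h ⋆ k" := (star theta h k) (at level 40, left associativity).

Lemma ncsP f g : (forall q, f q = g q) -> f = g.
Proof. by move=> E; apply/funext. Qed.

Lemma ncsDE f g q : (f + g) q = f q + g q. Proof. by []. Qed.
Lemma ncsNE f q : (- f) q = - f q. Proof. by []. Qed.
Lemma ncs0E q : (0 : ncs U) q = 0. Proof. by []. Qed.

Lemma starE N f g q : (q < N)%N -> (f ⋆ g) q =
  \sum_(a < N) \sum_(b < N) \sum_(c < N) moyal c (f a) (g b) *+ (a + b + c == q)%N.
Proof.
move=> qN; rewrite /star.
rewrite (big_ord_widen N (fun a => \sum_(b < (q - a).+1) moyal (q - a - b) (f a) (g b))) //.
rewrite big_mkcond; apply: eq_bigr => a _.
by rewrite (sum_antidiagonal a (fun b c => moyal c (f a) (g b)) qN) ltnS.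
Qed.

Lemma starDl f f' g : (f + f') ⋆ g = f ⋆ g + f' ⋆ g.
Proof.
apply: ncsP => q; rewrite ncsDE -big_split; apply: eq_bigr => a _.
by rewrite -big_split; apply: eq_bigr => b _; rewrite ncsDE moyalDl.
Qed.

Lemma starDr f g g' : f ⋆ (g + g') = f ⋆ g + f ⋆ g'.
Proof.
apply: ncsP => q; rewrite ncsDE -big_split; apply: eq_bigr => a _.
by rewrite -big_split; apply: eq_bigr => b _; rewrite ncsDE moyalDr.
Qed.

Lemma star0l g : 0 ⋆ g = 0.
Proof. by apply: (addrI (0 ⋆ g)); rewrite -starDl !addr0. Qed.

Lemma star0r f : f ⋆ 0 = 0.
Proof. by apply: (addrI (f ⋆ 0)); rewrite -starDr !addr0. Qed.

Lemma star_suml (I : Type) (r : seq I) (P : pred I) (F : I -> ncs U) g :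
  (\sum_(i <- r | P i) F i) ⋆ g = \sum_(i <- r | P i) F i ⋆ g.
Proof.
apply: (big_morph (fun f => f ⋆ g)) => [f f'|]; first exact: starDl.
exact: star0l.
Qed.

Lemma star_sumr (I : Type) (r : seq I) (P : pred I) (F : I -> ncs U) f :
  f ⋆ (\sum_(i <- r | P i) F i) = \sum_(i <- r | P i) f ⋆ F i.
Proof.
apply: (big_morph (star theta f)) => [g g'|]; first exact: starDr.
exact: star0r.
Qed.

Lemma star1r f : f ⋆ nc1 U = f.
Proof.
apply: ncsP => q; rewrite /star big_ord_recr /= big1 => [|a _].
  by rewrite subnn big_ord1 /nc1 /= moyal1r add0r.
rewrite big_ord_recl /nc1 /= moyal1r big1 => [|b _]; last by rewrite moyal0r.
by rewrite addr0 ifF //; have := ltn_ord a; lia.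
Qed.

Lemma star1l g : nc1 U ⋆ g = g.
Proof.
apply: ncsP => q; rewrite /star big_ord_recl /= addrC big1 => [|a _]; last first.
  by rewrite big1 // => b _; rewrite moyal0l.
rewrite add0r subn0 big_ord_recr /= big1 => [|b _].
  by rewrite subnn /nc1 /= moyal1l add0r.
by rewrite /nc1 /= moyal1l ifF //; have := ltn_ord b; lia.
Qed.

Lemma nc_pdD i f g : nc_pd i (f + g) = nc_pd i f + nc_pd i g.
Proof. by apply: ncsP => q; exact: pdD. Qed.

Lemma nc_pd_sum i (I : Type) (r : seq I) (P : pred I) (F : I -> ncs U) :
  nc_pd i (\sum_(k <- r | P k) F k) = \sum_(k <- r | P k) nc_pd i (F k).
Proof.
apply: (big_morph (nc_pd i)) => [f g|]; first exact: nc_pdD.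
by apply: ncsP => q; exact: pd0.
Qed.

Lemma nc_pd_comm i j f : nc_pd i (nc_pd j f) = nc_pd j (nc_pd i f).
Proof. by apply: ncsP => q; exact: pd_comm. Qed.

Lemma nc_pd_star i f g : nc_pd i (f ⋆ g) = nc_pd i f ⋆ g + f ⋆ nc_pd i g.
Proof.
apply: ncsP => q; rewrite ncsDE /nc_pd pd_sum -big_split; apply: eq_bigr => a _.
rewrite pd_sum -big_split; apply: eq_bigr => b _; exact: pd_moyal.
Qed.

Let moyal_mulrnl q u v (b : bool) : moyal q (u *+ b) v = moyal q u v *+ b.
Proof. by case: b; rewrite // !mulr0n moyal0l. Qed.

Let moyal_mulrnr q u v (b : bool) : moyal q u (v *+ b) = moyal q u v *+ b.
Proof. by case: b; rewrite // !mulr0n moyal0r. Qed.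

(** Eliminates the degree [p] of an inner product, which its own multiplicity forces to equal [k].
    If [k] is outside the range of [p], then [k > q] and both sides vanish. *)
Let sum_bool2 N q k m l (V : zmodType) (X : V) : (q < N)%N ->
  \sum_(p < N) X *+ (k == p :> nat) *+ (p + m + l == q)%N =
  X *+ (k + m + l == q)%N.
Proof.
move=> qN; case: (ltnP k N) => kN; last first.
  rewrite (_ : (_ == q) = false); last by lia.
  rewrite big1 // => p _; rewrite (_ : (k == p :> nat) = false) ?mul0rn //.
  by have := ltn_ord p; lia.
rewrite -(sum_ord_delta (fun p => X *+ (p + m + l == q)%N) kN).
by apply: eq_bigr => p _; rewrite eq_sym mulrnAC.
Qed.

(** Both sides are brought to a sum over the degrees [a], [b], [c] of the three series and [d], [e]
    of the outer and inner bidifferential operators. For fixed [a], [b], [c] what remains is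
    [moyalA]. *)
Lemma starA f g h : f ⋆ g ⋆ h = f ⋆ (g ⋆ h).
Proof.
apply: ncsP => q; set N := q.+1; have qN : (q < N)%N by [].
have L : (f ⋆ g ⋆ h) q = \sum_(a < N) \sum_(b < N) \sum_(c < N)
    \sum_(d < N) \sum_(e < N) moyal d (moyal e (f a) (g b)) (h c)
      *+ (a + b + c + d + e == q)%N.
  rewrite (starE _ _ qN).
  under eq_bigr => p _.
    under eq_bigr => c _.
      under eq_bigr => d _.
        rewrite (starE _ _ (ltn_ord p)) moyal_suml -sumrMnl.
        under eq_bigr => a _.
          rewrite moyal_suml -sumrMnl.
          under eq_bigr => b _.
            rewrite moyal_suml -sumrMnl.
            under eq_bigr => e _ do rewrite moyal_mulrnl.
            over.
          over.
        over.
      over.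
    over.
  rewrite exchange_big.
  (* The exchanges below move the sum over the intermediate degree [p] innermost, where [sum_bool2]
     removes it. *)
  transitivity (\sum_(c < N) \sum_(a < N) \sum_(b < N) \sum_(d < N) \sum_(e < N)
      moyal d (moyal e (f a) (g b)) (h c) *+ (a + b + c + d + e == q)%N).
    apply: eq_bigr => c _; rewrite exchange_big.
    under eq_bigr => d _ do rewrite exchange_big.
    rewrite exchange_big; apply: eq_bigr => a _.
    under eq_bigr => d _ do rewrite exchange_big.
    rewrite exchange_big; apply: eq_bigr => b _.
    apply: eq_bigr => d _; rewrite exchange_big; apply: eq_bigr => e _.
    by rewrite sum_bool2 //; congr (_ *+ _); congr nat_of_bool; lia.
  rewrite exchange_big; apply: eq_bigr => a _.
  by rewrite exchange_big.
have Rr : (f ⋆ (g ⋆ h)) q = \sum_(a < N) \sum_(b < N) \sum_(c < N)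
    \sum_(d < N) \sum_(e < N) moyal d (f a) (moyal e (g b) (h c))
      *+ (a + b + c + d + e == q)%N.
  rewrite (starE _ _ qN); apply: eq_bigr => a _.
  under eq_bigr => p _.
    under eq_bigr => d _.
      rewrite (starE _ _ (ltn_ord p)) moyal_sumr -sumrMnl.
      under eq_bigr => b _.
        rewrite moyal_sumr -sumrMnl.
        under eq_bigr => c _.
          rewrite moyal_sumr -sumrMnl.
          under eq_bigr => e _ do rewrite moyal_mulrnr (addnC a p).
          over.
        over.
      over.
    over.
  rewrite exchange_big.
  under eq_bigr => d _ do rewrite exchange_big.
  rewrite exchange_big; apply: eq_bigr => b _.
  under eq_bigr => d _ do rewrite exchange_big.
  rewrite exchange_big; apply: eq_bigr => c _.
  apply: eq_bigr => d _; rewrite exchange_big; apply: eq_bigr => e _.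
  by rewrite sum_bool2 //; congr (_ *+ _); congr nat_of_bool; lia.
rewrite L Rr; apply: eq_bigr => a _; apply: eq_bigr => b _; apply: eq_bigr => c _.
rewrite !(sum_antidiagonal (a + b + c) (fun d e => moyal d (moyal e _ _) _) qN).
rewrite (sum_antidiagonal (a + b + c) (fun d e => moyal d _ (moyal e _ _)) qN).
by rewrite moyalA.
Qed.

End Star.

(** * The reversal of the sign of hbar *)

Section Reversal.
Variables (R : realType) (n : nat) (M : topologicalType) (U : chart R n M).
Variable theta : 'M[R]_n.
Implicit Types f g h : ncs U.

Local Notation "h ⋆ k" := (star theta h k) (at level 40, left associativity).

Definition rev f : ncs U := fun q => (-1) ^+ q *: f q.

Lemma revD f g : rev (f + g) = rev f + rev g.
Proof. by apply: ncsP => q; rewrite /rev ncsDE scalerDr. Qed.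

Lemma revN f : rev (- f) = - rev f.
Proof. by apply: ncsP => q; rewrite /rev ncsNE scalerN. Qed.

Lemma rev_sum (I : Type) (r : seq I) (P : pred I) (F : I -> ncs U) :
  rev (\sum_(i <- r | P i) F i) = \sum_(i <- r | P i) rev (F i).
Proof.
apply: (big_morph rev) => [f g|]; first exact: revD.
by apply: ncsP => q; rewrite /rev ncs0E scaler0.
Qed.

Lemma revK : involutive rev.
Proof.
by move=> f; apply: ncsP => q; rewrite /rev scalerA -exprMn mulrNN mulr1 expr1n scale1r.
Qed.

Lemma rev_nc_pd i f : rev (nc_pd i f) = nc_pd i (rev f).
Proof. by apply: ncsP => q; rewrite /nc_pd /rev pdZ. Qed.

Lemma rev_delta (i j : 'I_n) : rev (nc_delta U i j) = nc_delta U i j.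
Proof.
apply: ncsP => q; rewrite /rev /nc_delta; case: eqP => _; last exact: scaler0.
by rewrite /nc1; case: q => [|q]; rewrite ?scale1r ?scaler0.
Qed.

(** Parity hypotheses enter the argument as equations [rev f = g]; [parity_rev] reads the
    conclusions back. *)
Lemma rev_parity f g : (forall q, f (2 * q)%N = g (2 * q)%N) ->
  (forall q, f (2 * q + 1)%N = - g (2 * q + 1)%N) -> rev f = g.
Proof.
move=> E O; apply: ncsP => q; rewrite /rev -signr_odd -[in f q](odd_double_half q).
rewrite -[in g q](odd_double_half q) -mul2n addnC.
by case: (odd q); rewrite /= ?expr1 ?expr0 ?O ?E ?addn0 ?E ?scale1r // scaleN1r opprK.
Qed.

Lemma parity_rev f g : rev f = g ->
  forall q, f (2 * q)%N = g (2 * q)%N /\ f (2 * q + 1)%N = - g (2 * q + 1)%N.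
Proof.
move=> <- q; rewrite /rev addn1 exprS mul2n -signr_odd odd_double expr0 scale1r.
by rewrite mulr1 scaleN1r opprK.
Qed.

(** In a term with [a + b + c = q], the coefficients of the factors account for the sign of [a + b],
    and exchanging the factors by [moyalC] for that of [c]. *)
Lemma rev_star f g : theta^T = - theta -> rev (f ⋆ g) = rev g ⋆ rev f.
Proof.
move=> skew; apply: ncsP => q; rewrite {1}/rev !(starE _ _ _ (ltnSn q)).
rewrite [RHS]exchange_big scaler_sumr; apply: eq_bigr => a _.
rewrite scaler_sumr; apply: eq_bigr => b _.
rewrite scaler_sumr; apply: eq_bigr => c _.
rewrite /rev moyalZl moyalZr (moyalC _ _ _ skew) !scalerA (addnC b a) -!exprD.
case: eqP => [abc|_]; last by rewrite !mulr0n scaler0.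
rewrite !mulr1n scalerA -exprD; congr (_ *: _).
by rewrite -[LHS]signr_odd -[RHS]signr_odd; congr (_ ^+ nat_of_bool _); lia.
Qed.

Lemma ncs_oppr_eq0 f : f = - f -> f = 0.
Proof.
move=> E; apply: ncsP => q; apply/eqP; move/(congr1 (fun h => h q)): E => /eqP.
rewrite ncsNE -addr_eq0 -mulr2n -scaler_nat scaler_eq0 pnatr_eq0 /=; exact.
Qed.

End Reversal.

(** * The metric in components and its inverse matrix *)

Section Geometry.
Variables (R : realType) (n : nat) (M : topologicalType) (U : chart R n M).
Variable theta : 'M[R]_n.
Variable g : nc_metric U theta.

Local Notation "h ⋆ k" := (star theta h k) (at level 40, left associativity).
Local Notation E := (lbasis U).
Local Notation Et := (rbasis U).
Local Notation G := (g_low g).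
Local Notation H := (g_up g).

Lemma star_delta f (F : 'I_n -> ncs U) j :
  (forall k, F k = nc_delta U k j) -> \sum_k f k ⋆ F k = f j.
Proof.
move=> FE; rewrite (bigD1 j) //= FE /nc_delta eqxx star1r big1 ?addr0 // => k kj.
by rewrite FE /nc_delta (negPf kj) star0r.
Qed.

Lemma delta_star f (F : 'I_n -> ncs U) j :
  (forall k, F k = nc_delta U j k) -> \sum_k F k ⋆ f k = f j.
Proof.
move=> FE; rewrite (bigD1 j) //= FE /nc_delta eqxx star1l big1 ?addr0 // => k kj.
by rewrite FE /nc_delta eq_sym (negPf kj) star0l.
Qed.

Lemma lvec_sumE (I : Type) (r : seq I) (F : I -> lvec U) k :
  (\sum_(i <- r) F i) k = \sum_(i <- r) F i k.
Proof. by apply: (big_morph (fun V : lvec U => V k)). Qed.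

Lemma lvec_expand (V : lvec U) : V = \sum_k lact theta (V k) (E k).
Proof.
apply/funext => l; rewrite lvec_sumE /lact.
by rewrite (@star_delta V (fun k => E k l) l).
Qed.

Lemma metric_suml (I : Type) (r : seq I) (F : I -> lvec U) W :
  g (\sum_(i <- r) F i) W = \sum_(i <- r) g (F i) W.
Proof.
apply: (big_morph (fun V => g V W)) => [V V'|]; first exact: metricDl.
by apply: (addrI (g 0 W)); rewrite -metricDl !addr0.
Qed.

Lemma metricE V l : g V (Et l) = \sum_k V k ⋆ G k l.
Proof.
rewrite {1}(lvec_expand V) metric_suml; apply: eq_bigr => k _.
exact: metric_lact.
Qed.

Lemma g_upP : inverse_matrix theta G H.
Proof. by rewrite /g_up; case: cid => ? []. Qed.

Lemma g_up_unique K : inverse_matrix theta G K -> K = H.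
Proof. by move=> KP; rewrite /g_up; case: cid => h [_ hu] /=; rewrite (hu K KP). Qed.

(** Multiply on the left by the inverse matrix. *)
Lemma g_low_cancel (X Y : 'I_n -> ncs U) :
  (forall m, \sum_l G m l ⋆ X l = \sum_l G m l ⋆ Y l) -> X =1 Y.
Proof.
have HG Z i : \sum_m H i m ⋆ (\sum_l G m l ⋆ Z l) = Z i.
  under eq_bigr do rewrite star_sumr.
  rewrite exchange_big /=.
  under eq_bigr => l _.
    under eq_bigr do rewrite -starA.
    rewrite -star_suml; over.
  rewrite (@delta_star Z (fun l => \sum_m H i m ⋆ G m l) i) // => l.
  by rewrite (g_upP l i).2 /nc_delta eq_sym.
by move=> XY i; rewrite -(HG X) -(HG Y); apply: eq_bigr => m _; rewrite XY.
Qed.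

(** * Connection coefficients, curvature and their reversal *)

Section Connection.
Variable D : left_connection U theta.

Lemma lnabla_sum i (I : Type) (r : seq I) (F : I -> lvec U) :
  D i (\sum_(k <- r) F k) = \sum_(k <- r) D i (F k).
Proof.
apply: (big_morph (D i)) => [V V'|]; first exact: lnablaD.
by apply: (addrI (D i 0)); rewrite -lnablaD !addr0.
Qed.

Lemma metric_lnabla i V l : g (D i V) (Et l) =
  \sum_k (nc_pd i (V k) ⋆ G k l + V k ⋆ Gamma_low g D i k l).
Proof.
rewrite {1}(lvec_expand V) lnabla_sum metric_suml; apply: eq_bigr => k _.
by rewrite lnabla_leibniz metricDl !metric_lact [g (D _ _) _]metricE.
Qed.

Variable Dt : right_connection U theta.
Variable Ups : 'I_n -> 'I_n -> 'I_n -> ncs U.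
Hypothesis hcan : canonical_connection g D Dt Ups.

Let T j k i l := \sum_m Gamma D j k m ⋆ Gammat_low g Dt i l m.

(** The derivative of [Gamma D j k m] is moved onto the lowered coefficient by the Leibniz rule. Of
    the two terms that compatibility gives for the derivative of the metric, one cancels against the
    connection term and the other leaves [T]. *)
Lemma riemannE l k i j : riemann g D l k i j =
  (nc_pd i (Gamma_low g D j k l) - T j k i l) -
  (nc_pd j (Gamma_low g D i k l) - T i k j l).
Proof.
have S i' j' : g (D i' (D j' (E k))) (Et l) =
    nc_pd i' (Gamma_low g D j' k l) - T j' k i' l.
  rewrite metric_lnabla /Gamma_low /T nc_pd_sum -sumrB; apply: eq_bigr => m _.
  by rewrite nc_pd_star (compatibility hcan) starDr addrA addrK.
rewrite /riemann /curvature -!S.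
by apply: (addIr (g (D j (D i (E k))) (Et l))); rewrite -metricDl !subrK.
Qed.


Hypothesis skew : theta^T = - theta.
Hypothesis rev_g : forall i j, rev (G i j) = G j i.

(** Reversal interchanges the left and right inverse equations, so the reversed transpose of [H] is
    again inverse to [G]; uniqueness of the inverse concludes. *)
Lemma rev_g_up i j : rev (H i j) = H j i.
Proof.
rewrite -[RHS](congr1 (fun K => K j i) (g_up_unique (K := fun i j => rev (H j i)) _)) //.
move=> {}i {}j; split.
  rewrite -(rev_delta U i j) -(g_upP i j).2 rev_sum.
  by apply: eq_bigr => k _; rewrite (rev_star _ _ skew) rev_g.
rewrite -(rev_delta U i j) -(g_upP i j).1 rev_sum.
by apply: eq_bigr => k _; rewrite (rev_star _ _ skew) rev_g.
Qed.

Hypothesis rev_Ups : forall i j k, rev (Ups i j k) = - Ups i j k.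

Local Notation Gl := (Gamma_low g D).
Local Notation Gtl := (Gammat_low g Dt).

(* The defect is symmetric in its first two arguments and antisymmetric in its
   last two. *)
Lemma rev_Gamma_low i j k : rev (Gl i j k) = Gtl i j k.
Proof.
pose X i j k := rev (Gl i j k) - Gtl i j k.
have Xsym a b c : X a b c = X b a c.
  rewrite /X /Gamma_low /Gammat_low /Gamma /Gammat.
  by rewrite (torsion_free_left hcan a b) (torsion_free_right hcan a b).
have Xanti a b c : X a b c = - X a c b.
  (* Compatibility for [G b c] is compared with the reversal of compatibility for [G c b]: both
     express the same derivative. Chirality then eliminates the reversed right coefficient. *)
  have C1 := compatibility hcan b c a.
  have C2 := congr1 (@rev _ _ _ _) (compatibility hcan c b a).
  move: C2; rewrite rev_nc_pd rev_g C1 revD => C2.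
  have U1 : rev (Gtl a b c) = rev (Gl a b c) + Ups a b c.
    rewrite -[Ups _ _ _]opprK -rev_Ups -(chirality hcan) revD revN.
    by rewrite opprD opprK addrA subrr add0r.
  have U2 : Ups a b c = Gl a b c - Gtl a b c by rewrite (chirality hcan).
  move: C2; rewrite U1 U2 /X [rev (Gl a b c) + _]addrCA [rev (Gl a c b) + _]addrCA.
  by move/addrI => ->; rewrite opprB [RHS]addrC addKr.
(* Alternating the two symmetries three times each returns to the original indices after three sign
   changes. *)
have : X i j k = - X i j k.
  by rewrite {1}Xanti Xsym Xanti opprK Xsym Xanti Xsym.
by move/ncs_oppr_eq0/eqP; rewrite subr_eq0 => /eqP.
Qed.

(** Reversing the lowered identity puts the metric on the left of both sides, where it can be
    cancelled. *)
Lemma rev_Gamma i j k : rev (Gamma D i j k) = Gammat Dt i j k.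
Proof.
apply: (g_low_cancel (X := fun k => rev (Gamma D i j k))) => m.
rewrite -/(Gammat_low g Dt i j m) -rev_Gamma_low /Gamma_low rev_sum.
by apply: eq_bigr => l _; rewrite (rev_star _ _ skew) rev_g.
Qed.

(** Reversal swaps the two factors and the two connections; associativity then moves the metric from
    the first factor to the second. *)
Let rev_T j k i l : rev (T j k i l) = T i l j k.
Proof.
rewrite /T rev_sum.
under eq_bigr => m _ do
  rewrite (rev_star _ _ skew) rev_Gamma -(rev_Gamma_low i l m) revK star_suml.
rewrite exchange_big; apply: eq_bigr => p _.
rewrite /Gammat_low star_sumr; apply: eq_bigr => m _; exact: starA.
Qed.

Lemma rev_riemann l k i j : rev (riemann g D l k i j) = riemann g D k l j i.
Proof.
rewrite !riemannE !(revD, revN) !rev_nc_pd !rev_T.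
rewrite !rev_Gamma_low.
(* The [T] terms already match. The derivative terms match because the two mixed second derivatives
   of [G l k], expanded by compatibility, are equal. *)
have := nc_pd_comm i j (G l k); rewrite !(compatibility hcan) !nc_pdD.
move: (nc_pd _ (Gl j l k)) (nc_pd _ (Gtl j k l)) (nc_pd _ (Gl i l k))
  (nc_pd _ (Gtl i k l)) (T i l j k) (T j l i k) => a b c d s t abcd.
apply/eqP; rewrite subr_eq addrAC eq_sym subr_eq !(addrACA _ (- s)).
by rewrite -abcd [b + a]addrC.
Qed.

Lemma rev_ricci i j : rev (ricci g D i j) = ricci_theta g D j i.
Proof.
rewrite /ricci /ricci_theta rev_sum [RHS]exchange_big; apply: eq_bigr => l _.
rewrite rev_sum; apply: eq_bigr => m _.
by rewrite (rev_star _ _ skew) rev_g_up rev_riemann.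
Qed.

(** The three factors come out in reverse order; what is left is to reorder the sums and
    rebracket. *)
Lemma rev_ricci_mixed i j : rev (ricci_mixed g D i j) = ricci_theta_mixed g D i j.
Proof.
rewrite /ricci_mixed /ricci_theta_mixed rev_sum.
under [RHS]eq_bigr do rewrite exchange_big.
rewrite [RHS]exchange_big; apply: eq_bigr => k _.
rewrite rev_sum [RHS]exchange_big; apply: eq_bigr => l _.
rewrite rev_sum; apply: eq_bigr => m _.
by rewrite !(rev_star _ _ skew) !rev_g_up rev_riemann starA.
Qed.

End Connection.

End Geometry.

Theorem theorem2p1 (R : realType) (n : nat) (M : smooth_manifold R n)
  (U : chart R n M) (hU : coordinate_chart U)
  (theta : 'M[R]_n) (theta_skew : theta^T = - theta)
  (g : nc_metric U theta)
  (Ups : 'I_n -> 'I_n -> 'I_n -> ncs U) (hUps : chiral_coefficients Ups)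
  (D : left_connection U theta) (Dt : right_connection U theta)
  (hcan : canonical_connection g D Dt Ups)
  (g_even : forall q i j, g_low g i j (2 * q)%N = g_low g j i (2 * q)%N)
  (g_odd : forall q i j,
    g_low g i j (2 * q + 1)%N = - g_low g j i (2 * q + 1)%N)
  (Ups_even : forall q i j k, Ups i j k (2 * q)%N = 0) :
  (forall q i j,
    ricci g D i j (2 * q)%N = ricci_theta g D j i (2 * q)%N /\
    ricci g D i j (2 * q + 1)%N = - ricci_theta g D j i (2 * q + 1)%N) /\
  (forall q i j,
    ricci_mixed g D i j (2 * q)%N = ricci_theta_mixed g D i j (2 * q)%N /\
    ricci_mixed g D i j (2 * q + 1)%N =
      - ricci_theta_mixed g D i j (2 * q + 1)%N).
Proof.
have rev_g i j : rev (g_low g i j) = g_low g j i.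
  by apply: rev_parity => q; [exact: g_even|exact: g_odd].
have rev_Ups i j k : rev (Ups i j k) = - Ups i j k.
  (* A series with only odd coefficients is negated by reversal. *)
  apply: rev_parity => q; rewrite !ncsNE ?opprK // Ups_even oppr0 //.
split=> q i j; apply: parity_rev.
  exact: rev_ricci hcan theta_skew rev_g rev_Ups i j.
exact: rev_ricci_mixed hcan theta_skew rev_g rev_Ups i j.
Qed.
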